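(* Let $L$ be a complete lattice and let $f: L\to L$ be a weak $\mathfrak{f}$-mapping on $L$. Then the binary operator $T: L^2\to L$ defined by $T(x,y)=f(x)\wedge_{\mathrm{Im}(f)} f(y)$ for all $x,y\in L$ is a left-continuous t-subnorm on $L$.
   Context: $L$ is a complete lattice with bottom element $0$ and top element $1$. A complete lattice $M$ is join-infinite distributive if $a\wedge(\bigvee S)=\bigvee_{s\in S}(a\wedge s)$ for all $a\in M$ and all nonempty $S\subseteq M$. A mapping $f:L\to L$ is a weak $\mathfrak{f}$-mapping if: (ii) $f(x)\le x$ for all $x\in L$; (iii) $f(f(x))=f(x)$ for all $x\in L$; (iv) $f(\bigvee S)=\bigvee_{s\in S}f(s)$ for every nonempty $S\subseteq L$; (v) the image $\mathrm{Im}(f)=\{f(x)\mid x\in L\}$ is a join-infinite distributive lattice under the partial order inherited from $L$. The symbol $\wedge_{\mathrm{Im}(f)}$ denotes the meet operation of the lattice $\mathrm{Im}(f)$ (with the order inherited from $L$); it need not coincide with the meet of $L$. A t-subnorm on $L$ is a binary operator $T:L^2\to L$ such that for all $a,b,c\in L$: $b\le c$ implies $T(a,b)\le T(a,c)$; $T(a,b)=T(b,a)$; $T(T(a,b),c)=T(a,T(b,c))$; and $T(a,b)\le a\wedge b$. It is left-continuous if $T(a,\bigvee S)=\bigvee_{s\in S}T(a,s)$ for all $a\in L$ and all nonempty $S\subseteq L$. *)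

(* Defs.v *)
From HB Require Import structures.
From mathcomp Require Import all_boot all_order.
From mathcomp Require Import boolp classical_sets.

Set Implicit Arguments.
Unset Strict Implicit.
Unset Printing Implicit Defensive.

Import Order.TTheory.
Local Open Scope classical_set_scope.
Local Open Scope order_scope.

Definition complete_lattice d (M : porderType d) : Prop :=
  forall S : set M, supremums S !=set0 /\ infimums S !=set0.

(* The library's [infimum x0 A] and [supremum x0 A] return the default [x0]
   when [A] is empty or has no infimum (supremum).  In a complete lattice the
   default therefore only matters for [A] empty, and below it is arbitrary
   wherever [A] is nonempty. *)
Definition poset_meet d (M : porderType d) (a b : M) : M :=
  infimum a [set a; b].

Definition join_infinite_distributive d (M : porderType d) : Prop :=
  complete_lattice M /\
  forall (a : M) (S : set M), S !=set0 ->
    poset_meet a (supremum a S) =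
    supremum a [set poset_meet a s | s in S].

(* Join in a lattice with a bottom element; the join of the empty set is
   [\bot]. *)
Definition join_set d (L : tbLatticeType d) (S : set L) : L :=
  supremum \bot S.

(* Im(f) as a partially ordered type of its own, with the order inherited
   from L, so that suprema and infima taken in it are those of Im(f) and not
   those of L. *)
Definition Im d (L : porderType d) (f : L -> L) : Type :=
  {x : L | x \in range f}.

Section ImOrder.
Context d (L : porderType d) (f : L -> L).
HB.instance Definition _ := SubChoice.on (Im f).
HB.instance Definition _ := [SubChoice_isSubPOrder of Im f by <: with d].
End ImOrder.

Definition to_Im d (L : porderType d) (f : L -> L) (x : L) : Im f :=
  exist _ (f x) (mem_set (imageT f x)).

Record weak_f_mapping d (L : tbLatticeType d) (f : L -> L) : Prop :=
  WeakFMapping {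
    weak_f_le : forall x, f x <= x;
    weak_f_idem : forall x, f (f x) = f x;
    weak_f_join : forall S : set L, S !=set0 ->
      f (join_set S) = join_set [set f s | s in S];
    weak_f_image : join_infinite_distributive (Im f)
  }.

Record t_subnorm d (L : tbLatticeType d) (T : L -> L -> L) : Prop :=
  TSubnorm {
    t_subnorm_mono : forall a b c, b <= c -> T a b <= T a c;
    t_subnorm_comm : forall a b, T a b = T b a;
    t_subnorm_assoc : forall a b c, T (T a b) c = T a (T b c);
    t_subnorm_le_meet : forall a b, T a b <= (a `&` b)%O
  }.

Definition left_continuous d (L : tbLatticeType d) (T : L -> L -> L) : Prop :=
  forall (a : L) (S : set L), S !=set0 ->
    T a (join_set S) = join_set [set T a s | s in S].

(* Main.v *)
(* Suprema in Im(f) agree with those of L, because f fixes its image and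
   preserves nonempty joins; left continuity of T is thus join-infinite
   distributivity of Im(f) at f(a), while the t-subnorm laws only use that the
   meet of Im(f) is a greatest lower bound and that f is monotone and
   decreasing. *)

Require Import Defs.
From mathcomp Require Import all_boot all_order.
From mathcomp Require Import boolp classical_sets.

Set Implicit Arguments.
Unset Strict Implicit.
Unset Printing Implicit Defensive.

Import Order.TTheory.
Local Open Scope classical_set_scope.
Local Open Scope order_scope.

Section CompleteLattice.
Context d (M : porderType d) (M_complete : complete_lattice M).
Implicit Types (a b c x : M) (S : set M).

Lemma supremum_spec x0 S : S !=set0 -> supremums S (supremum x0 S).
Proof.
move=> /set0P S0; have [[x xS] _] := M_complete S.
(* Neither default arises: [S] is nonempty, and the choice operator cannot fail since completeness
   supplies the supremum [x]. *)
by rewrite /supremum (negbTE S0); case: xgetP => [y _ //|/(_ x)].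
Qed.

Lemma infimum_spec x0 S : S !=set0 -> infimums S (infimum x0 S).
Proof.
move=> /set0P S0; have [_ [x xS]] := M_complete S.
by rewrite /infimum (negbTE S0); case: xgetP => [y _ //|/(_ x)].
Qed.

(** The universal property of the meet: through it the semilattice laws below reduce to laws of
    [&&]. *)
Lemma le_poset_meet x a b : (x <= poset_meet a b) = (x <= a) && (x <= b).
Proof.
have ab0 : [set a; b] !=set0 by exists a; left.
have [lb glb] := infimum_spec a ab0.
apply/idP/andP => [x_le | [xa xb]].
  by split; apply: le_trans x_le _; apply: lb; [left | right].
by apply: glb => _ [->|->].
Qed.

Lemma poset_meet_le a b : (poset_meet a b <= a) && (poset_meet a b <= b).
Proof. by rewrite -le_poset_meet. Qed.

(** Yoneda for posets: test at [x := a] and [x := b], then use antisymmetry. *)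
Lemma poset_eq a b : (forall x, (x <= a) = (x <= b)) -> a = b.
Proof. by move=> ab; apply/le_anti; rewrite -ab lexx ab lexx. Qed.

Lemma poset_meetC a b : poset_meet a b = poset_meet b a.
Proof. by apply: poset_eq => x; rewrite !le_poset_meet andbC. Qed.

Lemma poset_meetA a b c :
  poset_meet (poset_meet a b) c = poset_meet a (poset_meet b c).
Proof. by apply: poset_eq => x; rewrite !le_poset_meet andbA. Qed.

Lemma poset_meet_mono a b c : b <= c -> poset_meet a b <= poset_meet a c.
Proof.
have /andP[ma mb] := poset_meet_le a b.
by move=> bc; rewrite le_poset_meet ma (le_trans mb bc).
Qed.

End CompleteLattice.

Section WeakFMapping.
Context d (L : tbLatticeType d) (L_complete : complete_lattice L).
Context (f : L -> L) (f_weak : weak_f_mapping f).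

(** If [x <= y] then [y] is the join of [[set x; y]]; as [f] preserves this join, [f y] is an upper
    bound of [f x]. *)
Lemma weak_f_mono x y : x <= y -> f x <= f y.
Proof.
move=> xy; have S0 : [set x; y] !=set0 by exists x; left.
have fS0 : [set f s | s in [set x; y]] !=set0 by exists (f x), x; first left.
have <- : join_set [set x; y] = y.
  have [ub lub] := supremum_spec L_complete \bot S0.
  apply/le_anti/andP; split; last by apply: ub; right.
  by apply: lub => _ [->|->].
rewrite (weak_f_join f_weak S0).
have [ub _] := supremum_spec L_complete \bot fS0.
by apply: ub; exists x; first left.
Qed.

Lemma f_val (u : Im f) : f (val u) = val u.
Proof.
by case: u => x /= /set_mem[y _ <-]; rewrite (weak_f_idem f_weak).
Qed.

Lemma to_Im_val (u : Im f) : to_Im f (val u) = u.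
Proof. by apply: val_inj; rewrite /= f_val. Qed.

Lemma val_supremum (u0 : Im f) (A : set (Im f)) : A !=set0 ->
  val (supremum u0 A) = join_set [set val u | u in A].
Proof.
move=> A0; have [u Au] := A0.
have vA0 : [set val u | u in A] !=set0 by exists (val u), u.
have [ub lub] := supremum_spec (weak_f_image f_weak).1 u0 A0.
have [vub vlub] := supremum_spec L_complete \bot vA0.
(* The join taken in [L] is a fixed point of [f], hence lies in the image. *)
have f_join : f (join_set [set val u | u in A]) = join_set [set val u | u in A].
  rewrite (weak_f_join f_weak vA0) image_comp; congr join_set.
  by apply: eq_imagel => v _; exact: f_val.
apply/le_anti/andP; split; last first.
  by apply: vlub => _ [v Av <-]; rewrite Order.le_val; exact: ub.
(* Presenting the join as the value of an element of [Im f] makes it a competitor for the least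
   upper bound there. *)
rewrite -f_join -[f _]/(val (to_Im f _)) Order.le_val.
apply: lub => v Av; rewrite -Order.le_val /= f_join.
by apply: vub; exists v.
Qed.

Lemma to_Im_join (u0 : Im f) (S : set L) : S !=set0 ->
  to_Im f (join_set S) = supremum u0 [set to_Im f s | s in S].
Proof.
move=> S0; have [s Ss] := S0.
apply: val_inj; rewrite val_supremum; last by exists (to_Im f s), s.
by rewrite /= (weak_f_join f_weak S0) image_comp.
Qed.

End WeakFMapping.

Theorem theorem3p1 (d : Order.disp_t) (L : tbLatticeType d)
    (L_complete : complete_lattice L)
    (f : L -> L) (f_weak : weak_f_mapping f)
    (T : L -> L -> L)
    (T_def : forall x y : L, T x y = val (poset_meet (to_Im f x) (to_Im f y))) :
  t_subnorm T /\ left_continuous T.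
Proof.
have [Im_complete Im_distr] := weak_f_image f_weak.
split; [split|].
- move=> a b c bc; rewrite !T_def Order.le_val.
  apply: poset_meet_mono => //; rewrite -Order.le_val /=.
  exact: weak_f_mono.
- by move=> a b; rewrite !T_def poset_meetC.
(* An inner value of [T] is already in the image, so the outer [to_Im f] returns the inner meet
   unchanged. *)
- by move=> a b c; rewrite !T_def !to_Im_val// poset_meetA.
- move=> a b; rewrite T_def lexI.
  have /andP[] := poset_meet_le Im_complete (to_Im f a) (to_Im f b).
  rewrite -!Order.le_val /= => Ta Tb.
  by rewrite (le_trans Ta) ?(le_trans Tb)//; exact: weak_f_le.
- move=> a S S0; have [s Ss] := S0.
  have fS0 : [set to_Im f s | s in S] !=set0 by exists (to_Im f s), s.
  (* The default [to_Im f a] is chosen to match the one in [join_infinite_distributive], where the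
     default is the element being met. *)
  rewrite T_def (to_Im_join L_complete f_weak (to_Im f a) S0) Im_distr//.
  rewrite image_comp val_supremum//; last by eexists; exists s.
  rewrite image_comp; congr join_set.
  by apply: eq_imagel => x _; rewrite T_def.
Qed.
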